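(* It is not true that for every Polish space $X$ and every analytic (i.e. $\mathbf{\Sigma}^1_1$) set $A\subseteq X^\omega$, exactly one of the following holds: (a) $[X,A]\preceq_{B}[\omega,\neg\Delta^\omega(\omega)]$. (b) $[\omega^{\omega},\mathbb{A}_{\omega}]\preceq_{c}[X,A]$.
   Context: Here $\omega=\{0,1,2,\dots\}$ carries the discrete topology and $\omega^\omega$ the product topology. $\omega^{<\omega}$ is the set of finite sequences of elements of $\omega$, $|s|$ is the length of $s$, juxtaposition denotes concatenation, and $0^k$ is the sequence of $k$ zeros. For a set $Y$, $\Delta^\omega(Y):=\{(y_i)_{i\in\omega}\in Y^\omega\mid \forall i\in\omega\ \ y_i=y_0\}$, and $\neg\Delta^\omega(\omega):=\omega^\omega\setminus\Delta^\omega(\omega)$. For a map $u:X\to Y$, $u^\omega:X^\omega\to Y^\omega$ is defined by $u^\omega[(x_i)_{i\in\omega}]:=(u(x_i))_{i\in\omega}$. For Polish spaces $X,Y$ and $A\subseteq X^\omega$, $B\subseteq Y^\omega$, we write $[X,A]\preceq_B[Y,B]$ (resp. $[X,A]\preceq_c[Y,B]$) if there is a Borel (resp. continuous) map $u:X\to Y$ with $A\subseteq (u^\omega)^{-1}(B)$. Let $(p_n)_{n\in\omega}$ be the sequence of prime numbers, and define the injection $I:\omega^{<\omega}\to\omega$ by $I(\emptyset):=1$ and $I(s):=p_0^{s(0)+1}\cdots p_{|s|-1}^{s(|s|-1)+1}$ if $s\neq\emptyset$. Let $\varphi:I[\omega^{<\omega}]\to\omega$ be the increasing bijection, and $\psi_\omega:=(\varphi\circ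 I)^{-1}:\omega\to\omega^{<\omega}$, a bijection with $|\psi_\omega(n)|\le n$. Set $s^\omega_n:=\psi_\omega(n)0^{n-|\psi_\omega(n)|}$, a sequence of length $n$. Finally $$\mathbb{A}_\omega:=\{(s^\omega_n i\gamma)_{i\in\omega}\mid n\in\omega,\ \gamma\in\omega^\omega\}\subseteq(\omega^\omega)^\omega.$$ *)

(* Defs.v *)
From HB Require Import structures.
From mathcomp Require Import all_boot all_order all_algebra.
From mathcomp Require Import all_classical all_reals all_analysis.

Set Implicit Arguments.
Unset Strict Implicit.
Unset Printing Implicit Defensive.

Import Order.TTheory GRing.Theory Num.Theory.
Local Open Scope classical_set_scope.
Local Open Scope nat_scope.

(* Stated by hand because [completeType] is pointed, while the empty space is
   Polish. Nonnegativity of [d] follows from the first three clauses. *)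
Definition complete_metric_on (R : realType) (X : topologicalType)
    (d : X -> X -> R) : Prop :=
  [/\ forall x y, d x y = 0%R <-> x = y,
      forall x y, d x y = d y x,
      forall x y z, (d x z <= d x y + d y z)%R,
      forall (x : X) (U : set X),
        nbhs x U <-> exists2 e : R, (0 < e)%R & [set y | (d x y < e)%R] `<=` U
    & forall v : nat -> X,
        (forall e : R, (0 < e)%R -> exists N : nat,
           forall m n, N <= m -> N <= n -> (d (v m) (v n) < e)%R) ->
        exists l : X, v n @[n --> \oo] --> l].

Definition polish (R : realType) (X : topologicalType) : Prop :=
  (exists D : set X, countable D /\ dense D) /\
  (exists d : X -> X -> R, complete_metric_on d).

Definition analytic (R : realType) (X : topologicalType) (A : set X) : Prop :=
  exists (Y : topologicalType) (f : Y -> X),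
    [/\ polish R Y, continuous f & range f = A].

(* [measurable_fun] is unavailable here: [g_sigma_algebraType] is a measurable
   type only over a pointed carrier, while [X] may be empty. *)
Definition borel_fun (X Y : topologicalType) (u : X -> Y) : Prop :=
  forall B : set Y, <<s open >> B -> <<s open >> (u @^-1` B).

Definition diag_omega (Y : Type) : set (nat -> Y) :=
  [set y | forall i, y i = y 0].

Definition map_omega (X Y : Type) (u : X -> Y) (x : nat -> X) : nat -> Y :=
  fun i => u (x i).

Definition borel_reduces (X Y : topologicalType)
    (A : set {ptws nat -> X}) (B : set {ptws nat -> Y}) : Prop :=
  exists2 u : X -> Y, borel_fun u & A `<=` map_omega u @^-1` B.

Definition continuously_reduces (X Y : topologicalType)
    (A : set {ptws nat -> X}) (B : set {ptws nat -> Y}) : Prop :=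
  exists2 u : X -> Y, continuous u & A `<=` map_omega u @^-1` B.

Lemma ex_next_prime m : exists p, (m < p) && prime p.
Proof. by have [p mp pp] := prime_above m; exists p; rewrite mp. Qed.

Definition next_prime m := ex_minn (ex_next_prime m).

Fixpoint nth_prime n :=
  if n is n'.+1 then next_prime (nth_prime n') else 2.

Definition prime_code (s : seq nat) : nat :=
  \prod_(j < size s) nth_prime j ^ (nth 0 s j).+1.

(* The number of codes below [k]: on the set of codes, this is its increasing
   bijection onto [nat] (see [code_rank_lt], [code_rank_surj] below). *)
Definition code_rank (k : nat) : nat :=
  count (fun m => `[< range prime_code m >]) (iota 0 k).

Definition psi_omega (n : nat) : seq nat :=
  xget [::] [set s | code_rank (prime_code s) = n].

Definition s_omega (n : nat) : seq nat :=
  psi_omega n ++ nseq (n - size (psi_omega n)) 0.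

Definition prepend (s : seq nat) (g : nat -> nat) : nat -> nat :=
  fun k => if k < size s then nth 0 s k else g (k - size s).

Definition A_omega : set {ptws nat -> {ptws nat -> nat}} :=
  [set x | exists (n : nat) (g : {ptws nat -> nat}),
     forall i, x i = prepend (rcons (s_omega n) i) g].

Lemma next_primeP m :
  [/\ m < next_prime m, prime (next_prime m) &
      forall p, m < p -> prime p -> next_prime m <= p].
Proof.
rewrite /next_prime; case: ex_minnP => p /andP[mp pp] pmin.
by split => // q mq pq; apply: pmin; rewrite mq.
Qed.

Lemma nth_prime_prime n : prime (nth_prime n).
Proof. by case: n => //= n; have [] := next_primeP (nth_prime n). Qed.

Lemma nth_prime_lt : {homo nth_prime : m n / m < n}.
Proof.
apply: homo_ltn; first exact: ltn_trans.
by move=> n /=; have [] := next_primeP (nth_prime n).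
Qed.

Lemma nth_prime_inj : injective nth_prime.
Proof.
move=> m n e; apply/eqP; case: ltngtP => // /nth_prime_lt;
  by rewrite e ltnn.
Qed.

Lemma nth_prime_surj p : prime p -> exists n, nth_prime n = p.
Proof.
have n_lt n : n < nth_prime n.
  by elim: n => // n ih; apply: leq_ltn_trans ih (nth_prime_lt _).
move=> pp; elim: {2}p (n_lt p) => [|n ih].
  by rewrite ltnNge prime_gt1.
have [_ _ pmin] := next_primeP (nth_prime n).
move=> plt; have [/ih//|] := ltnP p (nth_prime n).
rewrite leq_eqVlt => /orP[/eqP e|/pmin/(_ pp)]; first by exists n.
by rewrite leqNgt plt.
Qed.

Lemma prime_code_gt0 s : 0 < prime_code s.
Proof.
by apply: prodn_gt0 => j; rewrite expn_gt0 prime_gt0 // nth_prime_prime.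
Qed.

Lemma prime_code_rcons s a :
  prime_code (rcons s a) = prime_code s * nth_prime (size s) ^ a.+1.
Proof.
rewrite /prime_code size_rcons big_ord_recr /= nth_rcons ltnn eqxx.
by congr (_ * _); apply: eq_bigr => i _; rewrite nth_rcons ltn_ord.
Qed.

Lemma logn_prime_code s j :
  logn (nth_prime j) (prime_code s) = if j < size s then (nth 0 s j).+1 else 0.
Proof.
elim/last_ind: s => [|s a ih]; first by rewrite /prime_code big_ord0 logn1.
rewrite prime_code_rcons lognM ?prime_code_gt0 //; last first.
  by rewrite expn_gt0 prime_gt0 // nth_prime_prime.
rewrite ih lognX logn_prime ?nth_prime_prime // (inj_eq nth_prime_inj).
rewrite size_rcons nth_rcons ltnS; case: (ltngtP j (size s)) => _ /=;
  by rewrite ?muln0 ?addn0 ?muln1 ?add0n.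
Qed.

Lemma prime_code_inj : injective prime_code.
Proof.
move=> s t e; have E j := congr1 (logn (nth_prime j)) e.
have sz : size s = size t.
  apply/eqP; case: ltngtP => // lt.
    by have := E (size s); rewrite !logn_prime_code ltnn lt.
  by have := E (size t); rewrite !logn_prime_code ltnn lt.
apply: (@eq_from_nth _ 0) => // i ilt.
by have := E i; rewrite !logn_prime_code -sz ilt => -[].
Qed.

Lemma code_rankS k :
  code_rank k.+1 = code_rank k + `[< range prime_code k >].
Proof. by rewrite /code_rank -addn1 iotaD count_cat /= addn0. Qed.

Lemma code_rank_le : {homo code_rank : k l / k <= l}.
Proof.
apply: homo_leq => [//||k]; first exact: leq_trans.
by rewrite code_rankS leq_addr.
Qed.

Lemma code_rank_lt k l :
  range prime_code k -> k < l -> code_rank k < code_rank l.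
Proof.
move=> /asboolT kP /code_rank_le; apply: leq_trans.
by rewrite code_rankS kP addn1.
Qed.

Lemma size_le_code_rank s : size s <= code_rank (prime_code s).
Proof.
elim/last_ind: s => // s a ih; rewrite size_rcons.
apply: leq_ltn_trans ih _; apply: code_rank_lt; first by exists s.
rewrite prime_code_rcons ltn_Pmulr ?prime_code_gt0 //.
apply: leq_trans (prime_gt1 (nth_prime_prime (size s))) _.
by rewrite -{1}(expn1 (nth_prime _)) leq_pexp2l // prime_gt0 // nth_prime_prime.
Qed.

Lemma code_rank_surj n : exists s, code_rank (prime_code s) = n.
Proof.
have := size_le_code_rank (nseq n.+1 0); rewrite size_nseq.
elim: (prime_code _) => // k ih; rewrite code_rankS.
have [/asboolW[s _ sk]|_] := boolP `[< range prime_code k >]; last first.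
  by rewrite addn0; apply: ih.
rewrite addn1 ltnS leq_eqVlt => /orP[/eqP ->|/ih//].
by exists s; rewrite sk.
Qed.

Lemma code_rank_inj : injective (code_rank \o prime_code).
Proof.
move=> s t /= e; apply: prime_code_inj; apply/eqP.
by case: ltngtP => // /(code_rank_lt (imageT _ _)); rewrite e ltnn.
Qed.

Lemma psi_omegaK n : code_rank (prime_code (psi_omega n)) = n.
Proof.
rewrite /psi_omega; case: xgetP => [s _ //|no].
by have [s sn] := code_rank_surj n; case: (no s).
Qed.

Lemma code_rankK s : psi_omega (code_rank (prime_code s)) = s.
Proof. by apply: code_rank_inj; rewrite /= psi_omegaK. Qed.

Lemma size_psi_omega n : size (psi_omega n) <= n.
Proof. by rewrite -{2}(psi_omegaK n) size_le_code_rank. Qed.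

Lemma size_s_omega n : size (s_omega n) = n.
Proof. by rewrite size_cat size_nseq subnKC // size_psi_omega. Qed.

(* Main.v *)
Require Import Defs.
From mathcomp Require Import all_boot all_order all_algebra.
From mathcomp Require Import all_classical all_reals all_analysis.

(** Call a point z of the Baire space tame if there are arbitrarily large K
    such that z takes only values below K on [0, K). Tame points form a dense
    G_delta set. The counterexample is the hypergraph A on the Baire space
    whose hyperedges are the sequences obtained from a tame point z by fixing
    a position p and letting the value at p run through 0, 1, 2, and so on:
    the i-th vertex is z with z(p) replaced by i. Both alternatives fail.

    (a) fails by Baire category ([tame_edge_not_below]). If c is a Borel
    colouring with countably many colours, some colour class is comeager below
    some finite sequence s. A generic g is then such that s 0 g is tame and all
    the points s i g have that colour: a monochromatic hyperedge.

    (b) fails because a homomorphism defined on the whole Baire space cannot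
    keep up with arbitrary growth ([tame_edge_not_above]). Let u be a
    continuous homomorphism. It maps the hyperedge of the points s_n i g to a
    hyperedge varying at a single position P(n, g), where the image of
    s_n i g has the value i. As any two finite sequences of the same length
    are joined by such hyperedges, it follows that u(s b g) has the value b at
    position P(n, g) for every s of length n, and not just for s_n, provided
    that b is fresh, i.e. occurs neither in s nor in s_0, ..., s_n
    ([fresh_value_at]).
    By continuity P(n, .) is constant on a neighbourhood of the zero sequence.
    So there are places n_0 < n_1 < ..., separated by blocks of zeros that are
    long enough for the positions q_k of the images to be known before any
    value is put at the places n_k. Putting there fresh values
    b_k >= q_(k+1) yields a point y such that u(y) has the value b_k at q_k.
    But u(y) is a vertex of a hyperedge, hence agrees, outside one position,
    with a tame z; that position is none of the q_k, because u(y) has the value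
    y(0) = 0 there, while b_k > 0. If K > q_0 bounds z on [0, K), then q_k < K gives
    q_(k+1) <= b_k < K, so that all q_k, and hence all b_k, are below K. This
    is absurd, since the b_k are unbounded. *)

Set Implicit Arguments.
Unset Strict Implicit.
Unset Printing Implicit Defensive.

Import Order.TTheory GRing.Theory Num.Theory.
Local Open Scope classical_set_scope.
Local Open Scope nat_scope.

(** * The topology of the Baire space *)

Local Notation baire := {ptws nat -> nat}.

Definition cylinder (x : baire) (n : nat) : set baire :=
  [set y | forall k, k < n -> y k = x k].

Lemma cylinder_le x m n : m <= n -> cylinder x n `<=` cylinder x m.
Proof. by move=> mn y xy k km; apply: xy; exact: leq_trans km mn. Qed.

Lemma nbhs_coord (x : baire) k : nbhs x [set y | y k = x k].
Proof.
have := @proj_continuous nat (fun=> nat) k x [set x k].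
by apply; rewrite nbhs_principalE.
Qed.

Lemma nbhs_cylinder (x : baire) n : nbhs x (cylinder x n).
Proof.
elim: n => [|n ih]; first by apply: filterS filterT => y _ k.
apply: filterS (filterI ih (nbhs_coord x n)) => y [xy xyn] k.
by rewrite ltnS leq_eqVlt => /predU1P[->|/xy].
Qed.

Lemma nbhs_baireP (x : baire) (U : set baire) :
  nbhs x U <-> exists n, cylinder x n `<=` U.
Proof.
split=> [|[n xU]]; last exact: filterS xU (nbhs_cylinder x n).
pose F : set_system baire := filter_from setT (cylinder x).
have FF : Filter F.
  apply: filter_from_filter; first by exists 0.
  move=> m n _ _; exists (maxn m n) => // y xy.
  by split; apply: cylinder_le xy; rewrite (leq_maxl, leq_maxr).
have : {ptws, F --> (x : nat -> nat)}.
  apply/(@pointwise_cvgP nat nat) => k V.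
  rewrite nbhs_principalE => /principal_filterP Vxk.
  by exists k.+1 => // y /= ->.
by move=> /[apply] -[n _ xU]; exists n.
Qed.

Lemma continuous_to_baire_power (f : baire -> {ptws nat -> baire}) :
  (forall y i k, exists n, forall y', cylinder y n y' -> f y' i k = f y i k) ->
  continuous f.
Proof.
move=> fP y.
apply/(@pointwise_cvgP nat baire) => i /=.
apply/(@pointwise_cvgP nat nat) => k V.
rewrite nbhs_principalE => /principal_filterP Vfy.
have [n yn] := fP y i k.
apply/(nbhs_baireP y); exists n => z /yn /= fz.
by rewrite /= fz.
Qed.

Lemma continuous_coord (u : baire -> baire) (y : baire) k :
  continuous u ->
  exists n, forall y', cylinder y n y' -> u y' k = u y k.
Proof.
by move=> /(_ y _ (nbhs_coord (u y) k)) /nbhs_baireP.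
Qed.

Section BaireMetric.
Variable R : realType.

Definition baire_dist (x y : baire) : R :=
  if pselect (exists n, x n != y n) is left xy
  then ((ex_minn xy).+1%:R^-1)%R else 0%R.

Lemma baire_dist_ltP x y n :
  (baire_dist x y < n.+1%:R^-1)%R <-> cylinder x n.+1 y.
Proof.
rewrite /baire_dist; case: pselect => [xy|xy].
  case: ex_minnP => m xym mmin; rewrite ltf_pV2 ?posrE// ltr_nat ltnS.
  split=> [nm k kn|xyn].
    apply/eqP; rewrite eq_sym; apply: contraTT nm => /mmin mk.
    by rewrite -leqNgt (leq_trans mk).
  by rewrite ltnNge; apply: contra xym => /(xyn m) ->.
split=> // _ k _; apply/eqP; rewrite eq_sym.
by apply: contrapT => /negP ?; apply: xy; exists k.
Qed.

Lemma baire_dist_ge0 x y : (0 <= baire_dist x y)%R.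
Proof. by rewrite /baire_dist; case: pselect. Qed.

Lemma baire_dist_eq0 x y : baire_dist x y = 0%R <-> x = y.
Proof.
split=> [xy0|->]; last first.
  by rewrite /baire_dist; case: pselect => // yy; case: ex_minnP => n; rewrite eqxx.
apply/funext => n; apply/esym.
suff: cylinder x n.+1 y by apply.
by apply/baire_dist_ltP; rewrite xy0 invr_gt0.
Qed.

Lemma baire_dist_sym x y : baire_dist x y = baire_dist y x.
Proof.
rewrite /baire_dist; case: pselect => xy; case: pselect => yx //.
- congr (_.+1%:R^-1)%R; case: ex_minnP => m xym mmin.
  case: ex_minnP => n yxn nmin; apply/eqP.
  by rewrite eqn_leq mmin ?nmin // eq_sym.
- by case: yx; case: xy => n; exists n; rewrite eq_sym.
- by case: xy; case: yx => n; exists n; rewrite eq_sym.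
Qed.

Lemma baire_dist_triangle x y z :
  (baire_dist x z <= baire_dist x y + baire_dist y z)%R.
Proof.
rewrite {1}/baire_dist; case: pselect => [xz|_]; last first.
  by rewrite addr_ge0 ?baire_dist_ge0.
case: ex_minnP => n xzn _.
have [xyn|xyn] := eqVneq (x n) (y n).
  apply: le_trans (_ : _ <= baire_dist y z)%R _; last first.
    by rewrite lerDr baire_dist_ge0.
  rewrite leNgt; apply/negP => /baire_dist_ltP /(_ n (ltnSn n)) zy.
  by rewrite xyn zy eqxx in xzn.
apply: le_trans (_ : _ <= baire_dist x y)%R _; last first.
  by rewrite lerDl baire_dist_ge0.
rewrite leNgt; apply/negP => /baire_dist_ltP /(_ n (ltnSn n)) yx.
by rewrite yx eqxx in xyn.
Qed.

Lemma small_inverse (e : R) :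
  (0 < e)%R -> exists n : nat, (n.+1%:R^-1 < e)%R.
Proof.
move=> e0; exists (Num.bound e^-1); rewrite -[ltRHS]invrK.
rewrite ltf_pV2 ?posrE ?invr_gt0 //.
apply: lt_trans (_ : _ < (Num.bound e^-1)%:R)%R _; last by rewrite ltr_nat.
by apply: archi_boundP; rewrite invr_ge0 ltW.
Qed.

Lemma complete_baire_dist : complete_metric_on baire_dist.
Proof.
split.
- exact: baire_dist_eq0.
- exact: baire_dist_sym.
- exact: baire_dist_triangle.
- move=> x U; split=> [/nbhs_baireP[n xU]|[e /small_inverse[n ne] xU]].
    exists (n.+1%:R^-1)%R; first by rewrite invr_gt0.
    by move=> y /baire_dist_ltP /(cylinder_le (leqnSn n)) /xU.
  apply/nbhs_baireP; exists n.+1 => y /baire_dist_ltP xy.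
  by apply: xU; exact: lt_trans xy ne.
- move=> v vC.
  have /choice[N NP] : forall k, exists N, forall m n, N <= m -> N <= n ->
      cylinder (v m) k.+1 (v n).
    move=> k; have [|N NP] := vC (k.+1%:R^-1)%R; first by rewrite invr_gt0.
    by exists N => m n Nm Nn; apply/baire_dist_ltP; exact: NP.
  exists (fun k => v (N k) k) => U /nbhs_baireP[n xU].
  exists (\max_(k < n) N k) => // m /= mN; apply: xU => k kn.
  have Nkm : N k <= m.
    by apply: leq_trans mN; exact: (leq_bigmax (Ordinal kn)).
  by rewrite (NP k (N k) m).
Qed.

Lemma polish_baire : polish R baire.
Proof.
split; last by exists baire_dist; exact: complete_baire_dist.
exists (range (fun s : seq nat => nth 0 s : baire)).
split; first by apply: sub_countable (card_image_le _ _) _; exact: countableP.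
move=> U [x Ux] oU.
have /nbhs_baireP[n xU] : nbhs x U by exact: open_nbhs_nbhs.
exists (nth 0 (mkseq x n)); split; last by exists (mkseq x n).
by apply: xU => k kn; rewrite nth_mkseq.
Qed.

End BaireMetric.

(** * Tame points and their hypergraph *)

Definition update (z : baire) (p i : nat) : baire :=
  fun k => if k == p then i else z k.

Definition tame : set baire :=
  [set z | forall N, exists2 K, N <= K & forall k, k < K -> z k < K].

Definition tame_edge : set {ptws nat -> baire} :=
  [set x | exists p z, tame z /\ forall i, x i = update z p i].

(** Tame points are not closed under limits, so they are parametrized together
    with witnesses: every [w] codes an unbounded set of bounds K, of which
    [ceiling w k] is the least one above [k]. It stays constant until [k]
    reaches it, and then jumps by an amount read off from [w k]. *)
Fixpoint ceiling (w : nat -> nat) (k : nat) : nat :=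
  if k is k'.+1 then
    if k < ceiling w k' then ceiling w k' else (k + w k).+1
  else (w 0).+1.

Lemma ceiling_gt w k : k < ceiling w k.
Proof. by case: k => //= k; case: ifP => // _; rewrite ltnS leq_addr. Qed.

Lemma ceiling_homo w : {homo ceiling w : j k / j <= k}.
Proof.
apply: homo_leq => // [|k]; first exact: leq_trans.
rewrite /=; case: ltnP => // /leq_trans; apply.
by rewrite -addSn leqW ?leq_addr // leqW // leq_addr.
Qed.

Lemma ceiling_stable w k j : k <= j -> j < ceiling w k -> ceiling w j = ceiling w k.
Proof.
move=> /subnKC <-; elim: (j - k) => [|d ih]; first by rewrite addn0.
rewrite addnS => kd; have E := ih (ltnW kd).
by rewrite /= E kd.
Qed.

Lemma ceiling_local w w' k :
  (forall j, j <= k -> w j = w' j) -> ceiling w k = ceiling w' k.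
Proof.
elim: k => [|k ih] ww /=; first by rewrite ww.
by rewrite ww // ih // => j jk; apply: ww; exact: leqW.
Qed.

(** A continuous retraction onto the tame points with bounds coded by [w]; it
    makes the whole Baire space a parameter space for the tame points. *)
Definition truncate (z w : nat -> nat) : baire :=
  fun k => if z k < ceiling w k then z k else 0.

Lemma tame_truncate z w : tame (truncate z w).
Proof.
move=> N; exists (ceiling w N) => [|k kN]; first exact/ltnW/ceiling_gt.
rewrite /truncate; have [zk|_] := ltnP (z k); last exact: leq_ltn_trans kN.
apply: leq_trans zk _; have [/ceiling_homo //|/ltnW Nk] := leqP k N.
by rewrite (ceiling_stable Nk).
Qed.

Lemma truncate_tame z : tame z -> exists w, truncate z w = z.
Proof.
move=> zH; have /choice[K KP] : forall k, exists K,
    k < K /\ forall j, j < K -> z j < K.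
  by move=> k; have [K kK KP] := zH k.+1; exists K.
(* With this [w] each jump of the ceiling at [k] is to [K k]. *)
pose w k := K k - k.+1; exists w; apply/funext => k; rewrite /truncate.
suff -> : z k < ceiling w k by [].
suff: forall j, j < ceiling w k -> z j < ceiling w k.
  by apply; exact: ceiling_gt.
elim: k => [|k ih] /=.
  by rewrite /w -addn1 subnK; have [] := KP 0.
case: ltnP => // _; rewrite /w -addSn subnKC; first by have [] := KP k.+1.
by have [] := KP k.+1.
Qed.

(** The parameter y codes the position in y(0), and the point and the bounds of
    [truncate] in the odd and in the nonzero even coordinates. *)
Lemma analytic_tame_edge (R : realType) : analytic R tame_edge.
Proof.
pose f (y : baire) : {ptws nat -> baire} := fun i =>
  update (truncate (fun k => y k.*2.+1) (fun k => y k.*2.+2)) (y 0) i.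
exists baire, f; split; first exact: polish_baire.
- apply: continuous_to_baire_power => y i k; exists k.*2.+3 => y' yy'.
  rewrite /f /update yy' // /truncate yy' ?ltnS //.
  rewrite (@ceiling_local _ (fun k => y k.*2.+2)) // => j jk.
  by rewrite yy' // !ltnS leq_double.
- rewrite eqEsubset; split=> [_ [y _ <-]|x [p [z [zH xE]]]].
    by exists (y 0), (truncate (fun k => y k.*2.+1) (fun k => y k.*2.+2));
      split=> //; exact: tame_truncate.
  have [w zw] := truncate_tame zH.
  exists (fun k => if k is k'.+1 then if odd k' then w k'./2 else z k'./2
                   else p) => //.
  apply/funext => i; rewrite xE /f /= -[in RHS]zw.
  congr (update (truncate _ _) _ _); apply/funext => k.
    by rewrite odd_double doubleK.
  by rewrite odd_double /= uphalf_double.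
Qed.

(** * Baire category and the failure of (a) *)

(** Dense open sets are given by sets of finite sequences, met by the initial
    segments of their members. So genericity is a matter of extending finite
    sequences. *)
Definition comeager (C : set baire) : Prop :=
  exists2 D : nat -> set (seq nat),
    (forall n s, exists t, D n (s ++ t)) &
    (forall g : baire, (forall n, exists k, D n (mkseq g k)) -> C g).

Definition shift (s : seq nat) (C : set baire) : set baire :=
  [set g | C (prepend s g)].

Lemma prepend_cat s t g : prepend (s ++ t) g = prepend s (prepend t g).
Proof.
apply/funext => k; rewrite /prepend size_cat nth_cat.
have [sk|sk] := ltnP k (size s); first by rewrite ltn_addr.
by rewrite subnDA ltn_subLR.
Qed.

Lemma shift_cat s t C : shift t (shift s C) = shift (s ++ t) C.
Proof. by apply/funext => g; rewrite /shift /= prepend_cat. Qed.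

Lemma shift_nil C : shift [::] C = C.
Proof.
apply/funext => g; rewrite /shift /=; congr C.
by apply/funext => k; rewrite /prepend /= subn0.
Qed.

Lemma mkseq_prepend s (g : baire) k :
  mkseq (prepend s g) (size s + k) = s ++ mkseq g k.
Proof.
apply: (@eq_from_nth _ 0) => [|i]; rewrite ?size_cat !size_mkseq // => ik.
rewrite nth_mkseq // nth_cat /prepend; case: ltnP => // si.
by rewrite nth_mkseq // ltn_subLR.
Qed.

Lemma prefix_mkseq (g : baire) s k :
  prefix s (mkseq g k) -> exists g', g = prepend s g'.
Proof.
move=> /prefixP[t gt]; exists (fun j => g (size s + j)).
apply/funext => i; rewrite /prepend; case: ltnP => si; last by rewrite subnKC.
have ik : i < k by rewrite -(size_mkseq g k) gt size_cat ltn_addr.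
by rewrite -(nth_mkseq 0 g ik) gt nth_cat si.
Qed.

Lemma comeager_countable (I : countType) (D : I -> set (seq nat)) (C : set baire) :
  (forall i s, exists t, D i (s ++ t)) ->
  (forall g : baire, (forall i, exists k, D i (mkseq g k)) -> C g) ->
  comeager C.
Proof.
move=> Ddense DC.
exists (fun n => if unpickle n is Some i then D i else setT) => [n s|g gD].
  by case: unpickle => [i|]; [exact: Ddense|exists [::]].
by apply: DC => i; have := gD (pickle i); rewrite pickleK.
Qed.

Lemma comeager_sub C C' : C `<=` C' -> comeager C -> comeager C'.
Proof. by move=> CC' [D Dd DC]; exists D => // g /DC /CC'. Qed.

Lemma comeager_bigcap (I : countType) (C : I -> set baire) :
  (forall i, comeager (C i)) -> comeager (\bigcap_i C i).
Proof.
move=> CC; have /choice[D DP] : forall i, exists D : nat -> set (seq nat),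
    (forall n s, exists t, D n (s ++ t)) /\
    (forall g : baire, (forall n, exists k, D n (mkseq g k)) -> C i g).
  by move=> i; have [D D1 D2] := CC i; exists D.
apply: (@comeager_countable (I * nat)%type (fun x => D x.1 x.2)) => [[i n] s|g gD i _].
  exact: (DP i).1.
by apply: (DP i).2 => n; exact: gD (i, n).
Qed.

Lemma comeagerI C C' : comeager C -> comeager C' -> comeager (C `&` C').
Proof.
move=> cC cC'; apply: comeager_sub (@comeager_bigcap bool (fun b => if b then C else C') _).
  by move=> g gC; split; [exact: (gC true)|exact: (gC false)].
by case.
Qed.

(** The Baire category theorem: extend a finite sequence into one dense set
    after the other and pass to the limit. *)
Lemma comeager_nonempty C : comeager C -> C !=set0.
Proof.
move=> [D Dd DC].
have /choice[e eP] : forall ns : nat * seq nat, exists t, D ns.1 (ns.2 ++ t).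
  by move=> [n s]; exact: Dd.
pose S := fix S n := if n is n'.+1 then
  (* The extra 0 makes the lengths tend to infinity. *)
  let s := rcons (S n') 0 in s ++ e (n', s) else [::].
have S_prefix m n : m <= n -> prefix (S m) (S n).
  move=> /subnKC <-; elim: (n - m) => [|d ih]; first by rewrite addn0 prefix_refl.
  rewrite addnS /=; apply: prefix_trans ih _.
  by rewrite cat_rcons prefix_prefix.
have S_size n : n <= size (S n).
  elim: n => // n ih /=; rewrite size_cat size_rcons.
  by apply: leq_trans (leq_addr _ _); rewrite ltnS.
pose g k := nth 0 (S k.+1) k.
have gS n : mkseq g (size (S n)) = S n.
  apply: (@eq_from_nth _ 0) => [|i]; rewrite size_mkseq // => iS.
  rewrite nth_mkseq // /g.
  have [/S_prefix|/ltnW /S_prefix] := leqP i.+1 n => /prefixP[t ->].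
    by rewrite [RHS]nth_cat (S_size i.+1).
  by rewrite [LHS]nth_cat iS.
exists g; apply: DC => n; exists (size (S n.+1)).
by rewrite gS /=; exact: (eP (n, _)).
Qed.

Lemma comeager_shift s C : comeager C -> comeager (shift s C).
Proof.
move=> [D Dd DC]; exists (fun n => [set t | D n (s ++ t)]) => [n t|g gD].
  by have [t' Dt'] := Dd n (s ++ t); exists t'; rewrite /= catA.
apply: DC => n; have [k] := gD n; rewrite /= -mkseq_prepend.
by exists (size s + k).
Qed.

(** A set that is comeager in the members of a pi-base is comeager. Here the
    union of the members below which [C] is comeager is one dense open set;
    for each such member s, the witnesses below s are made dense everywhere
    by adding all the sequences incompatible with s. As there are countably
    many s, no maximal antichain has to be chosen. *)
Lemma comeager_local C :
  (forall s, exists t, comeager (shift (s ++ t) C)) -> comeager C.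
Proof.
move=> Cloc.
have /choice[D DP] : forall s, exists D : nat -> set (seq nat),
    (forall n t, exists t', D n (t ++ t')) /\ (comeager (shift s C) ->
    forall g : baire, (forall n, exists k, D n (mkseq g k)) -> shift s C g).
  move=> s; have [[D D1 D2]|sC] := pselect (comeager (shift s C)).
    by exists D.
  by exists (fun=> setT); split=> // n t; exists [::].
pose W (x : option (nat * seq nat)) : set (seq nat) :=
  if x is Some (n, s)
  then [set t | size s <= size t /\ (prefix s t -> D s n (drop (size s) t))]
  else [set t | exists2 s, comeager (shift s C) & prefix s t].
apply: (@comeager_countable _ W) => [[[n s]|] t|g gW] /=.
(* Padding [t] to at least the length of [s] leaves two cases: it extends
   [s] or is incompatible with it. *)
- have st : size s <= size (t ++ nseq (size s) 0).
    by rewrite size_cat size_nseq leq_addl.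
  have [/prefixP[r tr]|nst] := boolP (prefix s (t ++ nseq (size s) 0)).
    have [r' Dr'] := (DP s).1 n r.
    exists (nseq (size s) 0 ++ r'); rewrite catA; split.
      by rewrite size_cat; exact: leq_trans st (leq_addr _ _).
    by rewrite tr -catA drop_size_cat.
  exists (nseq (size s) 0); split=> // st'.
  by rewrite st' in nst.
- have [t' ct'] := Cloc t; exists t', (t ++ t') => //.
  exact: prefix_refl.
- have [k [s sC sg]] := gW None.
  have [g' gE] := prefix_mkseq sg.
  rewrite gE; apply: (DP s).2 => // n.
  have [l [sl]] := gW (Some (n, s)).
  rewrite size_mkseq in sl.
  rewrite gE -(subnKC sl) mkseq_prepend prefix_prefix drop_size_cat // => /(_ isT).
  by exists (l - size s).
Qed.

(** The Baire property, in the form of a 0-1 law on a pi-base. *)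
Definition decided (B : set baire) : Prop :=
  forall s, exists t,
    comeager (shift (s ++ t) B) \/ comeager (shift (s ++ t) (~` B)).

Lemma comeagerT C : (forall g, C g) -> comeager C.
Proof. by move=> CT; exists (fun=> setT) => // n s; exists [::]. Qed.

Lemma open_decided U : open U -> decided U.
Proof.
move=> oU s; have [[t tU]|nU] := pselect (exists t, forall g, U (prepend (s ++ t) g)).
  by exists t; left; apply: comeagerT.
exists [::]; rewrite cats0; right; apply: comeagerT => g Ug; apply: nU.
have /nbhs_baireP[n gU] : nbhs (prepend s g : baire) U by exact: open_nbhs_nbhs.
exists (mkseq g n) => g'; apply: gU => k kn.
rewrite prepend_cat /prepend; case: ifP => // /negbT; rewrite -leqNgt => sk.
have kn' : k - size s < n by exact: leq_ltn_trans (leq_subr _ _) kn.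
by rewrite size_mkseq kn' nth_mkseq.
Qed.

(** For a countable union: if no member is comeager below any extension of s,
    the complements of all members are comeager below densely many extensions
    of s, hence below s, and so is their intersection. *)
Lemma sigma_algebra_decided : sigma_algebra setT decided.
Proof.
split.
- exact/open_decided/open0.
- move=> A dA s; have [t At] := dA s; exists t.
  by rewrite setTD setCK; case: At; [right|left].
- move=> A dA s.
  have [[n [t nt]]|nA] := pselect (exists n t, comeager (shift (s ++ t) (A n))).
    by exists t; left; apply: comeager_sub nt => g Ag; exists n.
  exists [::]; rewrite cats0; right.
  have : comeager (\bigcap_n shift s (~` A n)).
    apply: comeager_bigcap => n; apply: comeager_local => t.
    have [t' [At|At]] := dA n (s ++ t).
      by case: nA; exists n, (t ++ t'); rewrite catA.
    by exists t'; rewrite shift_cat catA.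
  by apply: comeager_sub => g gA [n _ An]; exact: gA An.
Qed.

Lemma borel_decided (B : set baire) : <<s open >> B -> decided B.
Proof. by apply: smallest_sub; [exact: sigma_algebra_decided|exact: open_decided]. Qed.

Lemma comeager_tame : comeager tame.
Proof.
exists (fun N => [set s | N <= size s /\ all (fun a => a < size s) s]) => [N s|g gD N].
  exists (nseq (maxn N (\max_(a <- s) a).+1) 0); rewrite /= size_cat size_nseq.
  split; first by rewrite -[N]add0n leq_add // leq_maxl.
  apply/allP => a; rewrite mem_cat mem_nseq => /orP[as_|/andP[m0 /eqP ->]].
    rewrite -[a.+1]add0n leq_add // leq_max ltnS orbC.
    by rewrite (@leq_bigmax_seq _ _ xpredT id).
  by rewrite addn_gt0 m0 orbT.
have [k /= []] := gD N; rewrite size_mkseq => Nk /allP gk; exists k => // j jk.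
by apply: gk; apply/mapP; exists j; rewrite ?mem_iota.
Qed.

Lemma update_prepend s (g : baire) i :
  update (prepend (rcons s 0) g) (size s) i = prepend (rcons s i) g.
Proof.
apply/funext => k; rewrite /update /prepend !size_rcons !nth_rcons ltnS.
by case: ltngtP.
Qed.

Lemma tame_edge_not_below :
  ~ @borel_reduces baire nat tame_edge (~` @diag_omega nat).
Proof.
move=> [c cB]; apply/existsNP.
have dB j : decided (c @^-1` [set j]).
  apply: borel_decided; apply: cB; apply: sub_sigma_algebra.
  exact: discrete_open.
have [j [s js]] : exists j s, comeager (shift s (c @^-1` [set j])).
  apply: contrapT => nj.
  suff /comeager_nonempty[g gc] : comeager (\bigcap_j ~` (c @^-1` [set j])).
    exact: (gc (c g)).
  apply: comeager_bigcap => j; apply: comeager_local => s.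
  have [t [ct|ct]] := dB j s; last by exists t.
  by case: nj; exists j, (s ++ t).
have /comeager_nonempty[g [gj gt]] : comeager
    ((\bigcap_i shift (rcons s i) (c @^-1` [set j])) `&` shift (rcons s 0) tame).
  apply: comeagerI; last exact/comeager_shift/comeager_tame.
  apply: comeager_bigcap => i; rewrite -cats1 -shift_cat.
  exact: comeager_shift.
exists (fun i => prepend (rcons s i) g); apply/not_implyP; split.
  exists (size s), (prepend (rcons s 0) g); split=> // i.
  by rewrite update_prepend.
by apply; move=> i; rewrite /map_omega (gj i I) (gj 0 I).
Qed.

(** * The failure of (b) *)

Lemma prepend_rcons s i g :
  prepend (rcons s i) g = prepend s (prepend [:: i] g).
Proof.
apply/funext => k; rewrite /prepend size_rcons nth_rcons ltnS /=.
case: ltngtP => [//|sk|->]; last by rewrite subnn.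
by rewrite -(subnSK sk) ltnS ltn0 subn1.
Qed.

Lemma prepend_split (y : baire) n :
  y = prepend (rcons (mkseq y n) (y n)) (fun j => y (n + j.+1)).
Proof.
apply/funext => k; rewrite /prepend size_rcons size_mkseq ltnS nth_rcons size_mkseq.
case: (ltngtP k n) => [kn|nk|->//]; first by rewrite nth_mkseq.
by rewrite -subSn // subSS subnKC // ltnW.
Qed.

Lemma cylinder_prepend s (g g' : baire) n :
  cylinder g n g' -> cylinder (prepend s g) n (prepend s g').
Proof.
move=> gg' k kn; rewrite /prepend; case: ifP => // _; apply: gg'.
exact: leq_ltn_trans (leq_subr _ _) kn.
Qed.

Section NoHomomorphism.
Variables (u : baire -> baire) (P : nat -> baire -> nat) (Z : nat -> baire -> baire).
Hypothesis cu : continuous u.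
Hypothesis tameZ : forall n g, tame (Z n g).
Hypothesis uE : forall n g i,
  u (prepend (rcons (s_omega n) i) g) = update (Z n g) (P n g) i.

(** The finite sequences of length k + 1 are connected by hyperedges: to change
    r i into r' i', replace r by s_k, then i by i' in one hyperedge, then s_k
    by r', recursively. If the position [p] were the one that varies in some
    hyperedge on this way, then the value [b] there would be an entry of one of
    these finite sequences; a fresh [b] is therefore never overwritten. *)
Lemma fresh_value_preserved k s s' g p b :
  size s = k -> size s' = k -> b \notin s -> b \notin s' ->
  (forall n, n < k -> b \notin s_omega n) ->
  u (prepend s g) p = b -> u (prepend s' g) p = b.
Proof.
elim: k => [|k ih] in s s' g *.
  by move=> /size0nil -> /size0nil ->.
case/lastP: s => // r i; case/lastP: s' => // r' i'.
rewrite !size_rcons => -[rk] -[r'k].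
rewrite !mem_rcons !inE !negb_or => /andP[bi br] /andP[bi' br'] fresh.
have freshk n : n < k -> b \notin s_omega n by move=> nk; apply/fresh/leqW.
have bk : b \notin s_omega k by exact: fresh.
have sk := size_s_omega k.
rewrite !prepend_rcons => /(ih _ _ _ rk sk br bk freshk).
move=> ub; apply: (ih _ _ _ sk r'k bk br' freshk); move: ub.
rewrite -!prepend_rcons !uE /update; case: eqP => // _ ib.
by rewrite ib eqxx in bi.
Qed.

Lemma fresh_value_at k s g b :
  size s = k -> b \notin s -> (forall n, n <= k -> b \notin s_omega n) ->
  u (prepend (rcons s b) g) (P k g) = b.
Proof.
move=> sk bs fresh; rewrite prepend_rcons.
apply: (fresh_value_preserved (size_s_omega k) sk) => //.
- exact: fresh.
- by move=> n nk; apply/fresh/ltnW.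
- by rewrite -prepend_rcons uE /update eqxx.
Qed.

(** If the values at a position differ between the vertices 0 and 1 of a
    hyperedge, then it is the position that varies; and by continuity these
    two values persist nearby. *)
Lemma position_locally_constant n (g : baire) :
  exists N, forall g', cylinder g N g' -> P n g' = P n g.
Proof.
have [N0 cN0] := continuous_coord (prepend (rcons (s_omega n) 0) g) (P n g) cu.
have [N1 cN1] := continuous_coord (prepend (rcons (s_omega n) 1) g) (P n g) cu.
exists (maxn N0 N1) => g' gg'.
have := cN0 _ (cylinder_prepend _ (cylinder_le (leq_maxl _ _) gg')).
have := cN1 _ (cylinder_prepend _ (cylinder_le (leq_maxr _ _) gg')).
rewrite !uE /update eqxx; case: eqP => [//|_ -> //].
Qed.

(** The diagonal construction. It is crucial that the places [nn k] and the
    positions [q k] are determined before the values [b k], which are then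
    chosen to exceed the next position. *)
Lemma no_continuous_homomorphism : False.
Proof.
pose zero : baire := fun=> 0.
have /choice[N NP] : forall n, exists N, forall g,
    cylinder zero N g -> P n g = P n zero.
  by move=> n; exact: position_locally_constant.
have /choice[E EP] : forall n, exists e, forall j a,
    j <= n -> a \in s_omega j -> a <= e.
  move=> n; exists (\max_(j < n.+1) \max_(a <- s_omega j) a) => j a jn aj.
  apply: leq_trans (leq_bigmax (Ordinal (jn : j < n.+1))).
  exact: (@leq_bigmax_seq _ _ xpredT id).
pose nn := fix nn k := if k is k'.+1 then nn k' + (N (nn k')).+1 else 1.
pose q k := P (nn k) zero.
pose b k := \sum_(j < k.+1) (q j.+1 + E (nn j)).+1.
have bS k : b k.+1 = b k + (q k.+2 + E (nn k.+1)).+1 by rewrite /b big_ord_recr.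
have b_ge k : q k.+1 + E (nn k) < b k.
  by rewrite /b big_ord_recr /= leq_addl.
have b_lt : {homo b : j k / j < k}.
  apply: homo_ltn; first exact: ltn_trans.
  by move=> k; rewrite bS -[ltnLHS]addn0 ltn_add2l.
have nn_lt : {homo nn : j k / j < k}.
  apply: homo_ltn; first exact: ltn_trans.
  by move=> k; rewrite /= -[ltnLHS]addn0 ltn_add2l.
have nn_mono j k : (nn j < nn k) = (j < k).
  by case: (ltngtP j k) => [/nn_lt|/nn_lt/ltnW|->]; rewrite ?ltnn // leqNgt => /negbTE.
(* [nn] starts at 1, so that [y 0 = 0] and [y] belongs to a hyperedge with
   index 0. *)
pose y : baire := fun x => xget 0 [set a | exists2 k, nn k = x & a = b k].
have y_nn k : y (nn k) = b k.
  rewrite /y; case: xgetP => [a _ [j jk ->]|/(_ (b k)) []]; last by exists k.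
  by congr b; apply/eqP; case: ltngtP => // /nn_lt; rewrite jk ltnn.
have y_cases x : y x = 0 \/ exists2 k, nn k = x & y x = b k.
  by rewrite /y; case: xgetP => [a -> [k kx ->]|]; [right; exists k|left].
have u_q k : u y (q k) = b k.
  rewrite [y](prepend_split y (nn k)) y_nn.
  pose g : baire := fun j => y (nn k + j.+1).
  rewrite -/g /q -(NP (nn k) g); last first.
    move=> j jN; rewrite /g; have [//|[l lx _]] := y_cases (nn k + j.+1).
    have : nn k < nn l < nn k.+1 by rewrite lx /= ltn_add2l -[ltnLHS]addn0 ltn_add2l.
    by rewrite !nn_mono => /andP[kl]; rewrite ltnS leqNgt kl.
  apply: fresh_value_at; first by rewrite size_mkseq.
    apply/negP => /mapP[x]; rewrite mem_iota /= => xk bx.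
    have [y0|[l lx yl]] := y_cases x.
      by move: (b_ge k); rewrite bx y0.
    rewrite -lx nn_mono in xk.
    by move: (b_lt _ _ xk); rewrite -yl -bx ltnn.
  move=> n nk; apply/negP => /(EP _ _ _ nk); apply/negP; rewrite -ltnNge.
  exact: leq_ltn_trans (leq_addl _ _) (b_ge k).
pose g : baire := fun j => y j.+1.
have y0 : y 0 = 0.
  by have [//|[[|k]]] := y_cases 0; rewrite //= addnS.
have u_y : u y = update (Z 0 g) (P 0 g) 0.
  rewrite -uE [y in LHS](prepend_split y 0) y0.
  by rewrite (size0nil (size_s_omega 0)).
have [K qK ZK] := tameZ 0 g (q 0).+1.
(* The position varying in this hyperedge is no [q k]: it has the value
   [y 0 = 0], while [b k] is positive. *)
have z_q k : Z 0 g (q k) = b k.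
  by have := u_q k; rewrite u_y /update; case: eqP => // _ b0; have := b_ge k; rewrite -b0.
have q_lt k : q k < K.
  elim: k => [//|k /ZK]; rewrite z_q; apply: leq_ltn_trans.
  exact: leq_trans (leq_addr _ _) (ltnW (b_ge k)).
have k_lt k : k < b k.
  elim: k => [|k ih]; first exact: leq_ltn_trans (b_ge 0).
  exact: leq_ltn_trans ih (b_lt _ _ (ltnSn k)).
by have := ZK _ (q_lt K); rewrite z_q ltnNge ltnW.
Qed.

End NoHomomorphism.

Lemma tame_edge_not_above :
  ~ @continuously_reduces baire baire A_omega tame_edge.
Proof.
move=> [u cu uA].
have /choice[P /choice[Z PZ]] : forall n, exists P : baire -> nat,
    exists Z : baire -> baire, forall g, tame (Z g) /\
    forall i, u (prepend (rcons (s_omega n) i) g) = update (Z g) (P g) i.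
  move=> n.
  have /choice[P /choice[Z PZ]] : forall g : baire, exists p, exists z, tame z /\
      forall i, u (prepend (rcons (s_omega n) i) g) = update z p i.
    move=> g; have [|p [z pz]] := uA (fun i => prepend (rcons (s_omega n) i) g).
      by exists n, g.
    by exists p, z.
  by exists P, Z.
by apply: (@no_continuous_homomorphism u P Z cu) => n g; have [] := PZ n g.
Qed.

Theorem theorem1p5 (R : realType) :
  ~ (forall (X : topologicalType) (A : set {ptws nat -> X}),
       polish R X -> analytic R A ->
       (@borel_reduces X nat A (~` @diag_omega nat) /\
          ~ @continuously_reduces {ptws nat -> nat} X A_omega A) \/
       (~ @borel_reduces X nat A (~` @diag_omega nat) /\
          @continuously_reduces {ptws nat -> nat} X A_omega A)).
Proof.
move=> dichotomy.
case: (dichotomy baire tame_edge (polish_baire R) (analytic_tame_edge R)).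
  by case=> /tame_edge_not_below.
by case=> _ /tame_edge_not_above.
Qed.
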